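(* For all $x>0$ and $\tau>0$, $$|K_{i\tau}(x)|\le\frac{\Gamma(1/4)}{\sqrt2}\;\frac{x^{-1/4}}{\sqrt{\sinh(\pi\tau)}} .$$
   Context: $K_{i\tau}(x)=\int_0^\infty e^{-x\cosh t}\cos(\tau t)\,dt$ ($x>0$) is the Macdonald function (modified Bessel function of the second kind) of imaginary index; $\Gamma$ is the Euler gamma function. *)

(* Defs.v *)
From mathcomp Require Import all_boot all_order all_algebra.
From mathcomp Require Import all_classical all_reals all_analysis.

Set Implicit Arguments.
Unset Strict Implicit.
Unset Printing Implicit Defensive.

Import Order.TTheory GRing.Theory Num.Theory.
Import numFieldNormedType.Exports.

Local Open Scope classical_set_scope.
Local Open Scope ring_scope.

Definition coshR (R : realType) (t : R) : R := (expR t + expR (- t)) / 2.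

Definition sinhR (R : realType) (t : R) : R := (expR t - expR (- t)) / 2.

(* Euler's integral, which converges (absolutely) exactly for a > 0; for other
   real a the value is the junk value of Rintegral, not the analytic
   continuation. *)
Definition GammaR (R : realType) (a : R) : R :=
  \int[@lebesgue_measure R]_(t in `]0, +oo[) (t `^ (a - 1) * expR (- t)).

(* K_{i tau}(x), a real number for real tau and x > 0; the integrand is then
   dominated by exp(- x cosh t), so the Lebesgue and improper Riemann integrals
   agree. *)
Definition macdonald_im (R : realType) (tau x : R) : R :=
  \int[@lebesgue_measure R]_(t in `[0, +oo[)
    (expR (- (x * coshR t)) * cos (tau * t)).

(* Main.v *)
Require Import Defs.
From mathcomp Require Import all_boot all_order all_algebra.
From mathcomp Require Import all_classical all_reals all_analysis.
From mathcomp Require Import measurable_realfun.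
From mathcomp Require Import ring lra.

Import Order.TTheory GRing.Theory Num.Theory.
Import numFieldNormedType.Exports.

Local Open Scope ring_scope.

Set Implicit Arguments.
Unset Strict Implicit.
Unset Printing Implicit Defensive.

(* Moving the contour of K_{i tau}(x) = Re int_0^oo exp(- x cosh z + i tau z) dz
   to the line Im z = th with 0 < th < pi/2 (the vertical side through 0 does
   not contribute to the real part) extracts a factor exp(- tau th) and leaves
   int_0^oo exp(- x cos th cosh t) cos(y sinh t - tau t) dt with y = x sin th.
   The weight is nonincreasing and at most 1, so by the second mean value
   theorem it suffices to bound int_0^T cos(y sinh t - tau t) dt uniformly in T.
   Since |y cosh t - tau| grows at least like (2/7) y |t - t0|^3 away from the
   stationary point t0, van der Corput's method bounds it by 3.3 y^(-1/4); the
   constant is kept by playing t0 against y^(-1/4).  Letting th tend to pi/2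
   gives |K_{i tau}(x)| <= 3.3 x^(-1/4) exp(- pi tau / 2), and
   Gamma(1/4) >= 3.3, 2 sinh(pi tau) <= exp(pi tau). *)

(** * Rules of differentiation, and comparison of functions through their derivatives *)

Section Derivatives.
Variable R : realType.
Implicit Types (f g : R -> R) (x : R).

(** Lets the rules below compute some derivative [d] first; its agreement with the wanted [df]
    becomes a separate algebraic goal. *)
Lemma der_eq f x df : (exists2 d, is_derive x 1 f d & d = df) ->
  is_derive x 1 f df.
Proof. by case=> d h <-. Qed.

Lemma der_cst (c x : R) : is_derive x 1 (fun=> c) 0.
Proof. exact: is_derive_cst. Qed.

Lemma der_id x : is_derive x 1 (fun t : R => t) 1.
Proof. exact: is_derive_id. Qed.

Lemma der_add f g x df dg : is_derive x 1 f df -> is_derive x 1 g dg ->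
  is_derive x 1 (fun t => f t + g t) (df + dg).
Proof. exact: is_deriveD. Qed.

Lemma der_opp f x df : is_derive x 1 f df -> is_derive x 1 (fun t => - f t) (- df).
Proof. exact: is_deriveN. Qed.

Lemma der_mul f g x df dg : is_derive x 1 f df -> is_derive x 1 g dg ->
  is_derive x 1 (fun t => f t * g t) (f x * dg + g x * df).
Proof. exact: is_deriveM. Qed.

Lemma der_expn f n x df : is_derive x 1 f df ->
  is_derive x 1 (fun t => f t ^+ n.+1) (n.+1%:R * f x ^+ n * df).
Proof.
move=> fx; elim: n => [|n ih].
  by rewrite expr0 !mul1r.
have -> : (fun t => f t ^+ n.+2) = (fun t => f t * f t ^+ n.+1).
  by apply/funext => t; rewrite exprS.
apply: der_eq; exists (f x * (n.+1%:R * f x ^+ n * df) + f x ^+ n.+1 * df).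
  exact: der_mul.
rewrite -[n.+2]addn1 natrD exprS; ring.
Qed.

Lemma der_comp f g x df dg : is_derive (g x) 1 f df -> is_derive x 1 g dg ->
  is_derive x 1 (fun t => f (g t)) (df * dg).
Proof.
by move=> fx gx; have h := is_derive1_comp fx gx; exact: h.
Qed.

Lemma der_expR f x df : is_derive x 1 f df ->
  is_derive x 1 (fun t => expR (f t)) (expR (f x) * df).
Proof. by move=> fx; apply: (der_comp _ fx). Qed.

Lemma der_cos f x df : is_derive x 1 f df ->
  is_derive x 1 (fun t => cos (f t)) (- sin (f x) * df).
Proof. by move=> fx; apply: (der_comp _ fx). Qed.

Lemma der_sin f x df : is_derive x 1 f df ->
  is_derive x 1 (fun t => sin (f t)) (cos (f x) * df).
Proof. by move=> fx; apply: (der_comp _ fx). Qed.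

Lemma der_inv f x df : f x != 0 -> is_derive x 1 f df ->
  is_derive x 1 (fun t => (f t)^-1) (- (f x) ^- 2 * df).
Proof.
move=> fx0 fx; have h := is_deriveV fx0 fx.
exact: h.
Qed.

Lemma der_continuous f x df : is_derive x 1 f df -> {for x, continuous f}.
Proof.
by move=> fx; apply: differentiable_continuous; apply/derivable1_diffP; case: fx.
Qed.

Lemma der_cosh f x df : is_derive x 1 f df ->
  is_derive x 1 (fun t => coshR (f t)) (sinhR (f x) * df).
Proof.
move=> fx; apply: der_eq; eexists.
  eapply der_mul; last exact: der_cst.
  by eapply der_add; eapply der_expR; [exact: fx|eapply der_opp; exact: fx].
rewrite /sinhR; ring.
Qed.

Lemma der_sinh f x df : is_derive x 1 f df ->
  is_derive x 1 (fun t => sinhR (f t)) (coshR (f x) * df).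
Proof.
move=> fx; apply: der_eq; eexists.
  eapply der_mul; last exact: der_cst.
  eapply der_add; first by eapply der_expR; exact: fx.
  by eapply der_opp; eapply der_expR; eapply der_opp; exact: fx.
rewrite /coshR; ring.
Qed.

(** The mean value theorem for [g - f]. It stands in for monotonicity of integrals: most estimates
    below compare primitives and form no integral. *)
Lemma le_of_derive_le f g df dg (a b : R) : a <= b ->
  (forall t, a <= t <= b -> is_derive t 1 f (df t)) ->
  (forall t, a <= t <= b -> is_derive t 1 g (dg t)) ->
  (forall t, a <= t <= b -> df t <= dg t) ->
  f b - f a <= g b - g a.
Proof.
move=> ab fd gd le.
have hd t : a <= t <= b -> is_derive t 1 (fun t => g t + - f t) (dg t + - df t).
  by move=> tab; apply: der_add; [exact: gd|apply: der_opp; exact: fd].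
have [|c cab] := @MVT_segment R _ (fun t => dg t + - df t) _ _ ab
  (fun t tab => hd t (subset_itv_oo_cc tab)).
  apply: continuous_in_subspaceT => t /[1!inE] /= tab.
  exact: der_continuous (hd t tab).
rewrite [_ \in _]in_itv /= in cab.
have := le c cab; nra.
Qed.

Lemma norm_le_of_derive_le f g df dg (a b : R) : a <= b ->
  (forall t, a <= t <= b -> is_derive t 1 f (df t)) ->
  (forall t, a <= t <= b -> is_derive t 1 g (dg t)) ->
  (forall t, a <= t <= b -> `|df t| <= dg t) ->
  `|f b - f a| <= g b - g a.
Proof.
move=> ab fd gd le; rewrite ler_norml; apply/andP; split.
  have -> : f b - f a = - ((- f b) - (- f a)) by ring.
  rewrite lerN2; apply: (@le_of_derive_le (fun t => - f t) _ (fun t => - df t) dg) => // t tab.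
    by apply: der_opp; exact: fd.
  by rewrite (le_trans _ (le _ tab))// ler_normr lexx orbT.
apply: (@le_of_derive_le _ _ df dg) => // t tab.
by rewrite (le_trans _ (le _ tab))// ler_norm.
Qed.

End Derivatives.

Ltac der := apply: der_eq; eexists;
  [ repeat first
    [ exact: der_cst | exact: der_id | eapply der_cosh | eapply der_sinh
    | eapply der_expn | eapply der_expR | eapply der_cos | eapply der_sin
    | eapply der_opp | eapply der_add | eapply der_mul ] | lazy beta ].

(** * Hyperbolic sine and cosine: polynomial lower bounds and convexity *)

Section Hyperbolic.
Variable R : realType.
Implicit Types a b t : R.

Lemma cosh0 : coshR 0 = 1 :> R.
Proof. by rewrite /coshR oppr0 expR0 mulfV// pnatr_eq0. Qed.

Lemma sinh0 : sinhR 0 = 0 :> R.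
Proof. by rewrite /sinhR oppr0 expR0 subrr mul0r. Qed.

Lemma sinhD a b : sinhR (a + b) = sinhR a * coshR b + coshR a * sinhR b.
Proof. rewrite /coshR /sinhR opprD !expRD; by field. Qed.

Lemma cosh_ge1 t : 1 <= coshR t.
Proof.
rewrite /coshR; have := expR_ge1Dx t; have := expR_ge1Dx (- t).
lra.
Qed.

(** Start of a chain: from [cosh_ge1] on, each Taylor lower bound up to [cosh_ge_quartic] is the
    previous one integrated from 0. *)
Lemma sinh_ge_id t : 0 <= t -> t <= sinhR t.
Proof.
move=> t0; have := @le_of_derive_le R (fun t => t) (fun t => sinhR t)
  (fun=> 1) (fun t => coshR t * 1) 0 t t0.
rewrite sinh0 !subr0; apply => // s _.
- by der.
- by rewrite mulr1 cosh_ge1.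
Qed.

Lemma cosh_ge_quadratic t : 0 <= t -> 1 + t ^+ 2 / 2 <= coshR t.
Proof.
move=> t0; have := @le_of_derive_le R (fun t => t ^+ 2 / 2) (fun t => coshR t)
  (fun t => t) (fun t => sinhR t * 1) 0 t t0.
rewrite cosh0 expr0n mul0r subr0 lerBrDl; apply => // s /andP[s0 _].
- der; by field.
- by der.
- by rewrite mulr1 sinh_ge_id.
Qed.

Lemma sinh_ge_cubic t : 0 <= t -> t + t ^+ 3 / 6 <= sinhR t.
Proof.
move=> t0; have := @le_of_derive_le R (fun t => t + t ^+ 3 / 6)
  (fun t => sinhR t) (fun t => 1 + t ^+ 2 / 2) (fun t => coshR t * 1) 0 t t0.
rewrite sinh0 expr0n mul0r !addr0 !subr0; apply => // s /andP[s0 _].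
- der; by field.
- by der.
- by rewrite mulr1 cosh_ge_quadratic.
Qed.

Lemma cosh_ge_quartic t : 0 <= t -> 1 + t ^+ 2 / 2 + t ^+ 4 / 24 <= coshR t.
Proof.
move=> t0; have := @le_of_derive_le R (fun t => t ^+ 2 / 2 + t ^+ 4 / 24)
  (fun t => coshR t) (fun t => t + t ^+ 3 / 6) (fun t => sinhR t * 1) 0 t t0.
rewrite cosh0 !expr0n !mul0r addr0 subr0 lerBrDl addrA; apply => // s /andP[s0 _].
- der; by field.
- by der.
- by rewrite mulr1 sinh_ge_cubic.
Qed.

(** Completing a square in [t ^+ 2 / 2 + t ^+ 4 / 24] yields a cubic with constant up to 1/sqrt 12;
    2/7 is slightly smaller. *)
Lemma cosh_sub1_ge t : 0 <= t -> 2 / 7 * t ^+ 3 <= coshR t - 1.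
Proof.
move=> t0; have := cosh_ge_quartic t0.
have h : 0 <= (t / 24 - 1 / 7) ^+ 2 * 24 + (1 / 2 - 24 / 49).
  by have := sqr_ge0 (t / 24 - 1 / 7); lra.
have := mulr_ge0 (sqr_ge0 t) h.
lra.
Qed.

(** [cosh_sub1_ge] integrated from 0. This is the growth of the phase that survives when the
    stationary point is at or near 0. *)
Lemma sinh_sub_id_ge t : 0 <= t -> t ^+ 4 / 14 <= sinhR t - t.
Proof.
move=> t0; have := @le_of_derive_le R (fun t => t ^+ 4 / 14)
  (fun t => sinhR t - t) (fun t => 2 / 7 * t ^+ 3) (fun t => coshR t - 1) 0 t t0.
rewrite sinh0 expr0n mul0r !subr0; apply => // s /andP[s0 _].
- der; by field.
- by der; ring.
- exact: cosh_sub1_ge.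
Qed.

(** Again a completed square, now in [t + t ^+ 3 / 6]; the best constant it allows, 2/sqrt 6, is a
    little above 4/5. *)
Lemma sinh_ge_square t : 0 <= t -> 4 / 5 * t ^+ 2 <= sinhR t.
Proof.
move=> t0; have := sinh_ge_cubic t0.
have h : 0 <= (t / 6 - 2 / 5) ^+ 2 * 6 + (1 - 24 / 25).
  by have := sqr_ge0 (t / 6 - 2 / 5); lra.
have := mulr_ge0 t0 h.
lra.
Qed.

Lemma sinh_ge0 t : 0 <= t -> 0 <= sinhR t.
Proof. by move=> t0; rewrite (le_trans t0)// sinh_ge_id. Qed.

Lemma cosh_le a b : 0 <= a -> a <= b -> coshR a <= coshR b.
Proof.
move=> a0 ab; rewrite -subr_ge0 -(subrr 0).
have := @le_of_derive_le R (fun=> 0) (fun t => coshR t)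
  (fun=> 0) (fun t => sinhR t * 1) a b ab.
apply => // t /andP[ta _].
- by der.
- by rewrite mulr1 sinh_ge0// (le_trans a0).
Qed.

Lemma cosh_ge_id t : 0 <= t -> t <= coshR t.
Proof. move=> t0; have := cosh_ge_quadratic t0; nra. Qed.

(** Convexity: [a - s] is the mean of 0 and [a] with weights [s / a] and [1 - s / a], so cosh lies
    below its chord there. Only the convexity of exp is used, between 0 and [a] and between 0 and
    [- a]. *)
Lemma cosh_chord a s : 0 < a -> 0 <= s <= a ->
  coshR (a - s) <= coshR a - (coshR a - 1) / a * s.
Proof.
move=> a0 /andP[s0 sa].
have ad : 0 <= s / a <= 1 by rewrite divr_ge0 ?(ltW a0)//= ler_pdivrMr// mul1r.
have cvx b : expR (s / a * 0 + (1 - s / a) * b) <= s / a * 1 + (1 - s / a) * expR b.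
  have := @convex_expR R (Itv01 (proj1 (andP ad)) (proj2 (andP ad))) 0 b.
  by rewrite !convRE /= expR0.
have h1 := cvx a; have h2 := cvx (- a).
have -> : (coshR a - 1) / a * s = s / a * (coshR a - 1) by ring.
have sa' : s = s / a * a by rewrite divfK// gt_eqF.
rewrite /coshR [in a - s]sa'; set k := s / a in h1 h2 *.
have -> : a - k * a = k * 0 + (1 - k) * a by ring.
have -> : - (k * 0 + (1 - k) * a) = k * 0 + (1 - k) * - a by ring.
lra.
Qed.

End Hyperbolic.

(** * Van der Corput estimates, stated for a primitive [A] of the cosine of a phase [psi] *)

Section Oscillatory.
Variable R : realType.
Implicit Types A psi f : R -> R.

(** Integration by parts: cos psi is the derivative of sin psi / f plus the remainder sin psi f' /
    f^2, and the remainder is at most the derivative of - 1 / f. *)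
Lemma oscillatory_large_slope A psi f f' (a b : R) : a <= b ->
  (forall s : R, a <= s <= b -> is_derive s 1 A (cos (psi s))) ->
  (forall s : R, a <= s <= b -> is_derive s 1 psi (f s)) ->
  (forall s : R, a <= s <= b -> is_derive s 1 f (f' s)) ->
  (forall s : R, a <= s <= b -> 0 < f s) ->
  (forall s : R, a <= s <= b -> 0 <= f' s) ->
  `|(A b - sin (psi b) / f b) - (A a - sin (psi a) / f a)| <= (f a)^-1 - (f b)^-1.
Proof.
move=> ab dA dpsi df f0 f'0.
have -> : (f a)^-1 - (f b)^-1 = (- (f b)^-1) - (- (f a)^-1) by ring.
have dinv s : a <= s <= b ->
    is_derive s 1 (fun s => (f s)^-1) (- (f s) ^- 2 * f' s).
  by move=> sab; apply: der_inv; [rewrite gt_eqF// f0|exact: df].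
apply: (@norm_le_of_derive_le R (fun s => A s - sin (psi s) / f s)
  (fun s => - (f s)^-1) (fun s => sin (psi s) * (f s ^- 2 * f' s))
  (fun s => f s ^- 2 * f' s)) => // s sab.
- apply: der_eq; eexists.
    eapply der_add; first exact: dA.
    eapply der_opp; eapply der_mul; last exact: dinv.
    by eapply der_sin; exact: dpsi.
  have fs : f s != 0 by rewrite gt_eqF// f0.
  by lazy beta; field.
- by apply: der_eq; eexists; [eapply der_opp; exact: dinv|lazy beta; ring].
- rewrite normrM [X in _ * X]ger0_norm; last first.
    by rewrite mulr_ge0 ?f'0// invr_ge0 sqr_ge0.
  rewrite ler_piMl//; last by rewrite ler_norml sin_geN1 sin_le1.
  by rewrite mulr_ge0 ?f'0// invr_ge0 sqr_ge0.
Qed.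

(** Subtracting the derivative of [p * sin (psi s)] leaves [(1 - p * f s) * cos (psi s)], which is
    at most [1 - p * f s], the derivative of [s - p * psi s]. *)
Lemma oscillatory_small_slope A psi f (p a b : R) : a <= b ->
  (forall s : R, a <= s <= b -> is_derive s 1 A (cos (psi s))) ->
  (forall s : R, a <= s <= b -> is_derive s 1 psi (f s)) ->
  (forall s : R, a <= s <= b -> p * f s <= 1) ->
  `|(A b - p * sin (psi b)) - (A a - p * sin (psi a))| <=
    (b - p * psi b) - (a - p * psi a).
Proof.
move=> ab dA dpsi pf.
apply: (@norm_le_of_derive_le R (fun s => A s - p * sin (psi s))
  (fun s => s - p * psi s) (fun s => (1 - p * f s) * cos (psi s))
  (fun s => 1 - p * f s)) => // s sab.
- apply: der_eq; eexists.
    eapply der_add; first exact: dA.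
    eapply der_opp; eapply der_mul; first exact: der_cst.
    by eapply der_sin; exact: dpsi.
  by lazy beta; ring.
- apply: der_eq; eexists.
    eapply der_add; first exact: der_id.
    by eapply der_opp; eapply der_mul; [exact: der_cst|exact: dpsi].
  by lazy beta; ring.
- have pf0 : 0 <= 1 - p * f s by rewrite subr_ge0 pf.
  by rewrite normrM (ger0_norm pf0) ler_piMr// ler_norml cos_geN1 cos_le1.
Qed.

(* Multiplying by min(p, 1/psi') and integrating by parts costs at most 2p in
   boundary terms and variation; what is left is the integral of
   1 - p psi' over the set where p psi' <= 1, which is at most W. *)
Lemma oscillatory_bound A psi f f' (a b p W : R) : 0 <= a -> a <= b -> 0 < p ->
  (forall s : R, 0 <= s <= b -> is_derive s 1 A (cos (psi s))) ->
  (forall s : R, 0 <= s <= b -> is_derive s 1 psi (f s)) ->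
  (forall s : R, 0 <= s <= b -> is_derive s 1 f (f' s)) ->
  (forall s : R, 0 <= s <= b -> 0 <= f' s) ->
  (forall s : R, 0 <= s <= b -> s - p * (psi s - psi 0) <= W) ->
  `|A b - A a| <= 2 * p + W.
Proof.
move=> a0 ab p0 dA dpsi df f'0 hW.
have sub s c d : 0 <= c -> d <= b -> c <= s <= d -> 0 <= s <= b.
  by move=> c0 db /andP[cs sd]; rewrite (le_trans c0 cs) (le_trans sd db).
have sin1 s : `|sin (psi s)| <= 1 by rewrite ler_norml sin_geN1 sin_le1.
have fmono s t : 0 <= s -> s <= t -> t <= b -> f s <= f t.
  move=> s0 st tb; rewrite -subr_ge0 -(subrr 0).
  apply: (@le_of_derive_le R (fun=> 0) f (fun=> 0) f' s t) => //.
  - by move=> u /(sub _ _ _ s0 tb) /df.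
  - by move=> u /(sub _ _ _ s0 tb) /f'0.
have W0 : 0 <= W.
  by have := hW 0; rewrite lexx (le_trans a0 ab) !subrr mulr0 subr0; apply.
have bb : b <= b by [].
have large c : 0 <= c -> c <= b -> p^-1 <= f c ->
    `|A b - A c - (sin (psi b) / f b - sin (psi c) / f c)| <= (f c)^-1 - (f b)^-1.
  move=> c0 cb fc.
  have -> : A b - A c - (sin (psi b) / f b - sin (psi c) / f c) =
    (A b - sin (psi b) / f b) - (A c - sin (psi c) / f c) by ring.
  apply: (@oscillatory_large_slope A psi f f') => // s scb.
  - exact/dA/(sub _ _ _ c0 bb).
  - exact/dpsi/(sub _ _ _ c0 bb).
  - exact/df/(sub _ _ _ c0 bb).
  - case/andP: scb => cs sb; rewrite (lt_le_trans _ (fmono c s c0 cs sb))//.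
    by rewrite (lt_le_trans _ fc)// invr_gt0.
  - exact/f'0/(sub _ _ _ c0 bb).
(* As [f] is nondecreasing, the slope is large on all of [a, b] in this case, and the total is at
   most 2 / f a. *)
have [fa|fa] := leP p^-1 (f a).
  have h := large a a0 ab fa.
  have fa0 : 0 < f a by rewrite (lt_le_trans _ fa)// invr_gt0.
  have fb0 : 0 < f b by rewrite (lt_le_trans fa0)// fmono.
  have pa : (f a)^-1 <= p by rewrite -[leRHS]invrK lef_pV2// posrE invr_gt0.
  have ia0 : 0 < (f a)^-1 by rewrite invr_gt0.
  have ib0 : 0 < (f b)^-1 by rewrite invr_gt0.
  have hb : `|sin (psi b) / f b| <= (f b)^-1.
    by rewrite normrM (gtr0_norm ib0) ler_piMl// ltW.
  have ha : `|sin (psi a) / f a| <= (f a)^-1.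
    by rewrite normrM (gtr0_norm ia0) ler_piMl// ltW.
  move: h ha hb; rewrite !ler_norml.
  move=> /andP[h1 h2] /andP[h3 h4] /andP[h5 h6]; apply/andP; split; lra.
have small c : a <= c -> c <= b -> f c <= p^-1 ->
    `|A c - A a - (p * sin (psi c) - p * sin (psi a))| <= W.
  move=> ac cb fc.
  have c0 := le_trans a0 ac.
  have pf s : 0 <= s <= c -> p * f s <= 1.
    case/andP=> s0 sc; rewrite -ler_pdivlMl// mulr1.
    by rewrite (le_trans _ fc)// fmono.
  have -> : A c - A a - (p * sin (psi c) - p * sin (psi a)) =
    (A c - p * sin (psi c)) - (A a - p * sin (psi a)) by ring.
  apply: (@le_trans _ _ ((c - p * psi c) - (a - p * psi a))).
    apply: (@oscillatory_small_slope A psi f) => // s sac.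
    - exact/dA/(sub _ _ _ a0 cb).
    - exact/dpsi/(sub _ _ _ a0 cb).
    - by apply: pf; case/andP: sac => as_ ->; rewrite (le_trans a0 as_).
  (* Since [p * f s <= 1] on [0, a] as well, [s - p * psi s] is nondecreasing there, so the lower
     endpoint [a] can be replaced by 0, as the hypothesis on [W] requires. *)
  have : 0 <= (a - p * psi a) - (0 - p * psi 0).
    rewrite -[X in X <= _](subrr 0).
    apply: (@le_of_derive_le R (fun=> 0) (fun s => s - p * psi s) (fun=> 0)
      (fun s => 1 - p * f s)) => // s s0a.
    - apply: der_eq; eexists.
        eapply der_add; first exact: der_id.
        eapply der_opp; eapply der_mul; first exact: der_cst.
        by apply: dpsi; exact: sub s0a.
      by lazy beta; ring.
    - rewrite subr_ge0 pf//; case/andP: s0a => -> sa.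
      by rewrite (le_trans sa ac).
  have : c - p * (psi c - psi 0) <= W by apply: hW; rewrite c0 cb.
  lra.
have psin s : `|p * sin (psi s)| <= p by rewrite normrM (gtr0_norm p0) ler_piMr// ltW.
have [fb|fb] := leP (f b) p^-1.
  have := small b ab bb fb; have := psin a; have := psin b.
  rewrite !ler_norml.
  move=> /andP[h1 h2] /andP[h3 h4] /andP[h5 h6]; apply/andP; split; lra.
(* At the crossing point [c] both multipliers equal [p], so the boundary terms at [c] cancel. *)
have [||c cab fc] := @IVT R f a b p^-1 ab.
- apply: continuous_in_subspaceT => t /[1!inE] /= tab.
  apply: (@der_continuous _ _ _ (f' t)); apply: df.
  by apply: (sub _ _ _ a0 bb); move: tab; rewrite in_itv.
- by rewrite ge_min (ltW fa) le_max (ltW fb) orbT.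
rewrite in_itv /= in cab; case/andP: cab => ac cb.
have c0 := le_trans a0 ac.
have := small c ac cb; rewrite fc => /(_ (lexx _)) h1.
have := large c c0 cb; rewrite fc invrK => /(_ (lexx _)) h2.
have fb0 : 0 < f b by rewrite (lt_trans _ fb)// invr_gt0.
have ib0 : 0 < (f b)^-1 by rewrite invr_gt0.
have hb : `|sin (psi b) / f b| <= (f b)^-1.
  by rewrite normrM (gtr0_norm ib0) ler_piMl// ltW.
have ha := psin a.
move: h1 h2 ha hb; rewrite !ler_norml.
move=> /andP[h1 h2] /andP[h3 h4] /andP[h5 h6] /andP[h7 h8].
apply/andP; split; lra.
Qed.

(** By parts: [E t - al t * (A t - A 0)] has a derivative bounded by [- M * al' t], which costs
    [M * (al 0 - al T)]; the boundary term at [T] costs the missing [M * al T]. *)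
Lemma second_mean_value_bound A E al g al' (M T : R) : 0 <= T ->
  (forall t : R, 0 <= t <= T -> is_derive t 1 A (g t)) ->
  (forall t : R, 0 <= t <= T -> is_derive t 1 E (al t * g t)) ->
  (forall t : R, 0 <= t <= T -> is_derive t 1 al (al' t)) ->
  (forall t : R, 0 <= t <= T -> al' t <= 0) -> 0 <= al T ->
  (forall t : R, 0 <= t <= T -> `|A t - A 0| <= M) ->
  `|E T - E 0| <= M * al 0.
Proof.
move=> T0 dA dE dal al'0 alT hM.
have TT : 0 <= T <= T by rewrite T0 lexx.
have : `|(E T - al T * (A T - A 0)) - (E 0 - al 0 * (A 0 - A 0))| <=
    - M * al T - - M * al 0.
  apply: (@norm_le_of_derive_le R (fun t => E t - al t * (A t - A 0))
    (fun t => - M * al t) (fun t => - (al' t * (A t - A 0)))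
    (fun t => - M * al' t)) => // t tT.
  - apply: der_eq; eexists.
      eapply der_add; first exact: dE.
      eapply der_opp; eapply der_mul; first exact: dal.
      by eapply der_add; [exact: dA|exact: der_cst].
    by lazy beta; ring.
  - apply: der_eq; eexists.
      by eapply der_mul; [exact: der_cst|exact: dal].
    by lazy beta; ring.
  - rewrite normrN normrM ler0_norm ?al'0// mulrC !mulNr -mulrN.
    by rewrite ler_wpM2r ?hM// oppr_ge0 al'0.
have := hM T TT.
rewrite subrr mulr0 subr0 !ler_norml.
move=> /andP[h1 h2] /andP[h3 h4]; apply/andP; split; nra.
Qed.

End Oscillatory.

(** * Uniform bound for the primitive of cos(y sinh t - tau t) *)

Section HyperbolicPhase.
Variable R : realType.

(** The left side is largest at [s = k], so the difference has [k] as a double root. *)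
Lemma quartic_bound (k s : R) : 0 < k -> 4 * k ^+ 3 * s - s ^+ 4 <= 3 * k ^+ 4.
Proof.
move=> k0; rewrite -subr_ge0.
have -> : 3 * k ^+ 4 - (4 * k ^+ 3 * s - s ^+ 4) =
  (s - k) ^+ 2 * ((s + k) ^+ 2 + 2 * k ^+ 2) by ring.
by rewrite mulr_ge0 ?sqr_ge0// addr_ge0 ?sqr_ge0// mulr_ge0 ?sqr_ge0.
Qed.

Definition phase (y tau t : R) := y * sinhR t - tau * t.

Lemma der_phase (y tau t : R) : is_derive t 1 (phase y tau) (y * coshR t - tau).
Proof. by rewrite /phase; der; ring. Qed.

Lemma der_shift (t0 s : R) : is_derive s 1 (fun s => t0 + s) 1.
Proof. by der; ring. Qed.

(** The sides differ by [(y * coshR t0 - tau) * s] plus [y * (coshR t0 - 1) * (sinhR s - s)]. Of the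
    lower bound, [sinhR s - s] serves [right_quartic] and the other term [right_quadratic]. *)
Lemma phase_growth (y tau t0 s : R) : 0 < y -> 0 <= t0 -> 0 <= s -> tau <= y * coshR t0 ->
  y * (sinhR s - s + sinhR t0 * (coshR s - 1)) <= phase y tau (t0 + s) - phase y tau t0.
Proof.
move=> y0 t00 s0 ht; rewrite /phase sinhD -subr_ge0.
have h1 : 0 <= (y * coshR t0 - tau) * s by rewrite mulr_ge0// subr_ge0.
have h2 : 0 <= (coshR t0 - 1) * (sinhR s - s) * y.
  by rewrite !mulr_ge0 ?subr_ge0 ?cosh_ge1 ?sinh_ge_id// ltW.
lra.
Qed.

Lemma right_bound (A : R -> R) (y tau t0 b p W : R) : 0 < y ->
  (forall t : R, 0 <= t -> is_derive t 1 A (cos (phase y tau t))) ->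
  0 <= t0 -> 0 <= b -> 0 < p ->
  (forall s : R, 0 <= s <= b -> s - p * (phase y tau (t0 + s) - phase y tau t0) <= W) ->
  `|A (t0 + b) - A t0| <= 2 * p + W.
Proof.
move=> y0 dA t00 b0 p0 hW.
have := @oscillatory_bound R (fun s => A (t0 + s)) (fun s => phase y tau (t0 + s))
  (fun s => y * coshR (t0 + s) - tau) (fun s => y * sinhR (t0 + s)) 0 b p W.
rewrite addr0; apply => // s /andP[s0 sb].
- have ts0 : 0 <= t0 + s by rewrite addr_ge0.
  apply: der_eq; eexists; first by eapply der_comp; [exact: dA|exact: der_shift].
  by rewrite mulr1.
- apply: der_eq; eexists; first by eapply der_comp; [exact: der_phase|exact: der_shift].
  by rewrite mulr1.
- by der; ring.
- by rewrite mulr_ge0 ?(ltW y0)// sinh_ge0// addr_ge0.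
Qed.

(** Uses only the quartic growth, hence is uniform in [t0]. With [s = r * w], the quantity bounded
    by W is at most w (r - r^4 / (4 k^3)), which [quartic_bound] controls by 3 k w / 4. *)
Lemma right_quartic (A : R -> R) (y tau w t0 b : R) :
  0 < y -> 0 < w -> 1 <= y * w ^+ 4 ->
  (forall t : R, 0 <= t -> is_derive t 1 A (cos (phase y tau t))) ->
  0 <= t0 -> 0 <= b -> tau <= y * coshR t0 ->
  `|A (t0 + b) - A t0| <= 231 / 100 * w.
Proof.
move=> y0 w0 yw dA t00 b0 ht.
(* The total (7 / k^3 + 3 k / 4) w is least at k = 28^(1/4), and 7/3 is close to it. *)
pose k : R := 7 / 3.
pose p := 27 / 98 * w. (* 7 w / (2 k^3) *)
have p0 : 0 < p by rewrite /p; lra.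
apply: (@le_trans _ _ (2 * p + 3 / 4 * k * w)); last by rewrite /p /k; lra.
apply: (right_bound y0 dA) => //.
move=> s /andP[s0 sb].
have hp : y * s ^+ 4 / 14 <= phase y tau (t0 + s) - phase y tau t0.
  apply: le_trans (phase_growth y0 t00 s0 ht).
  rewrite -mulrA ler_pM2l// (le_trans (sinh_sub_id_ge s0))// lerDl.
  by rewrite mulr_ge0 ?sinh_ge0// subr_ge0 cosh_ge1.
have [r sE] : exists r, s = r * w by exists (s / w); rewrite divfK// gt_eqF.
have hr : r ^+ 4 * w <= y * s ^+ 4 * w.
  rewrite ler_pM2r// sE exprMn mulrCA.
  by rewrite ler_peMr// exprn_even_ge0.
have h1 := ler_wpM2l (ltW p0) hp.
have h2 : (4 * k ^+ 3 * r - r ^+ 4) * w <= 3 * k ^+ 4 * w.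
  by rewrite ler_pM2r// quartic_bound// /k; lra.
rewrite /p /k in h1 h2 *.
rewrite sE in h1 hr *.
lra.
Qed.

(** Completes a square in [s]. The right side is the W of [oscillatory_bound] for p = q w / u, when
    the phase grows at least quadratically. *)
Lemma quadratic_window (y w c q u s d : R) : 0 < w -> 1 <= y * w ^+ 4 ->
  0 < q -> 0 < u -> 0 < c ->
  c * (y * u ^+ 2 * w ^+ 2 * s ^+ 2) <= d ->
  s - q * w / u * d <= 1 / (4 * c * q) * w / u.
Proof.
move=> w0 yw q0 u0 c0 hd.
have [r sE] : exists r, s = r * w by exists (s / w); rewrite divfK// gt_eqF.
have hr : r ^+ 2 <= y * s ^+ 2 * w ^+ 2.
  have -> : y * s ^+ 2 * w ^+ 2 = r ^+ 2 * (y * w ^+ 4) by rewrite sE; ring.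
  by rewrite ler_peMr// sqr_ge0.
have h1 : q * w / u * (c * u ^+ 2 * r ^+ 2) <= q * w / u * d.
  rewrite ler_pM2l ?divr_gt0 ?mulr_gt0//; apply: le_trans hd.
  have -> : c * (y * u ^+ 2 * w ^+ 2 * s ^+ 2) = c * u ^+ 2 * (y * s ^+ 2 * w ^+ 2).
    by ring.
  by rewrite ler_pM2l// mulr_gt0// exprn_gt0.
have h2 : 0 <= (2 * c * q * u * r - 1) ^+ 2 / (4 * c * q * u) * w.
  by rewrite mulr_ge0 ?(ltW w0)// divr_ge0 ?sqr_ge0// !mulr_ge0// ltW.
have h3 : (2 * c * q * u * r - 1) ^+ 2 / (4 * c * q * u) * w =
    q * w / u * (c * u ^+ 2 * r ^+ 2) - s + 1 / (4 * c * q) * w / u.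
  by rewrite sE; field; rewrite !gt_eqF.
lra.
Qed.

Lemma right_quadratic (A : R -> R) (y tau w t0 b u : R) :
  0 < y -> 0 < w -> 1 <= y * w ^+ 4 ->
  (forall t : R, 0 <= t -> is_derive t 1 A (cos (phase y tau t))) ->
  0 < u -> t0 = u * w -> 0 <= b ->
  tau <= y * coshR t0 -> `|A (t0 + b) - A t0| <= 56 / 25 * w / u.
Proof.
move=> y0 w0 yw dA u0 t0E b0 ht.
have t00 : 0 <= t0 by rewrite t0E mulr_ge0// ltW.
have wu : 0 < w / u by rewrite divr_gt0.
(* The growth constant 2/5 is half the 4/5 of [sinh_ge_square]; 14/25 is near sqrt 5 / 4, the
   minimiser of 2 q + 5 / (8 q). *)
apply: (@le_trans _ _ (2 * (14 / 25 * w / u) + 1 / (4 * (2 / 5) * (14 / 25)) * w / u)).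
  have q0 : (0 : R) < 14 / 25 by lra.
  have c0 : (0 : R) < 2 / 5 by lra.
  apply: (right_bound y0 dA) => //; first lra.
  move=> s /andP[s0 sb]; apply: (quadratic_window w0 yw q0 u0 c0).
  have hs : 4 / 5 * (u * w) ^+ 2 <= sinhR t0 by rewrite -t0E sinh_ge_square.
  apply: le_trans (phase_growth y0 t00 s0 ht).
  have -> : 2 / 5 * (y * u ^+ 2 * w ^+ 2 * s ^+ 2) =
    y * (4 / 5 * (u * w) ^+ 2 * (s ^+ 2 / 2)) by field.
  rewrite ler_pM2l// -[X in X <= _]add0r lerD ?subr_ge0 ?sinh_ge_id//.
  rewrite ler_pM//.
  - by rewrite mulr_ge0 ?sqr_ge0.
  - by rewrite divr_ge0 ?sqr_ge0.
  - by have := cosh_ge_quadratic s0; lra.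
lra.
Qed.

(** Reflection at the stationary point: the slope [tau - y * coshR (t0 - s)] is nondecreasing in
    [s], and [cosh_chord] makes it grow at least linearly up to [s = t0]. *)
Lemma left_quadratic (A : R -> R) (y tau w t0 a b u : R) :
  0 < y -> 0 < w -> 1 <= y * w ^+ 4 ->
  (forall t : R, 0 <= t -> is_derive t 1 A (cos (phase y tau t))) ->
  0 < u -> t0 = u * w -> tau = y * coshR t0 ->
  0 <= a -> a <= b -> b <= t0 -> `|A (t0 - b) - A (t0 - a)| <= 15 / 4 * w / u.
Proof.
move=> y0 w0 yw dA u0 t0E ht a0 ab bt0.
have t00 : 0 < t0 by rewrite t0E mulr_gt0.
have wu : 0 < w / u by rewrite divr_gt0.
have drefl (s : R) : is_derive s 1 (fun s => t0 - s) (- 1) by der; ring.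
(* The growth constant is 1/7, and 14/15 is near sqrt(7/8), the minimiser of 2 q + 7 / (4 q). *)
apply: (@le_trans _ _
    (2 * (14 / 15 * w / u) + 1 / (4 * (1 / 7) * (14 / 15)) * w / u)).
  have -> : `|A (t0 - b) - A (t0 - a)| = `|(- A (t0 - b)) - (- A (t0 - a))|.
    by rewrite -normrN; congr `|_|; ring.
  have := @oscillatory_bound R (fun s => - A (t0 - s)) (fun s => phase y tau (t0 - s))
    (fun s => tau - y * coshR (t0 - s)) (fun s => y * sinhR (t0 - s)) a b
    (14 / 15 * w / u) (1 / (4 * (1 / 7) * (14 / 15)) * w / u).
  apply => //.
  - lra.
  - move=> s /andP[s0 sb].
    have ts0 : 0 <= t0 - s by rewrite subr_ge0 (le_trans sb).
    apply: der_eq; eexists.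
      by eapply der_opp; eapply der_comp; [exact: dA|exact: drefl].
    by ring.
  - move=> s _; apply: der_eq; eexists.
      by eapply der_comp; [exact: der_phase|exact: drefl].
    by ring.
  - by move=> s _; der; ring.
  - move=> s /andP[s0 sb].
    by rewrite mulr_ge0 ?(ltW y0)// sinh_ge0// subr_ge0 (le_trans sb).
  - have q0 : (0 : R) < 14 / 15 by lra.
    have c0 : (0 : R) < 1 / 7 by lra.
    move=> s /andP[s0 sb]; apply: (quadratic_window w0 yw q0 u0 c0).
    have st0 := le_trans sb bt0.
    rewrite subr0.
    (* The chord inequality integrated from 0 to [s]. *)
    have h1 : (coshR t0 - 1) / t0 * (s ^+ 2 / 2) <=
        sinhR (t0 - s) - sinhR t0 + coshR t0 * s.
      have := @le_of_derive_le R (fun s => (coshR t0 - 1) / t0 * (s ^+ 2 / 2))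
        (fun s => sinhR (t0 - s) + coshR t0 * s)
        (fun s => (coshR t0 - 1) / t0 * s) (fun s => coshR t0 - coshR (t0 - s))
        0 s s0.
      rewrite expr0n mul0r !mulr0 !subr0 addr0 addrAC; apply.
      - by move=> r _; der; field; rewrite gt_eqF.
      - by move=> r _; der; ring.
      - move=> r /andP[r0 rs].
        have := @cosh_chord R t0 r t00; rewrite r0 (le_trans rs st0) => /(_ isT).
        lra.
    have h2 : 2 / 7 * t0 ^+ 2 <= (coshR t0 - 1) / t0.
      rewrite ler_pdivlMr//; have := cosh_sub1_ge (ltW t00).
      by have -> : 2 / 7 * t0 ^+ 2 * t0 = 2 / 7 * t0 ^+ 3 by ring.
    have -> : phase y tau (t0 - s) - phase y tau t0 = y * (sinhR (t0 - s) - sinhR t0 + coshR t0 * s).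
      by rewrite /phase ht; ring.
    have -> : 1 / 7 * (y * u ^+ 2 * w ^+ 2 * s ^+ 2) =
      y * (2 / 7 * t0 ^+ 2 * (s ^+ 2 / 2)) by rewrite t0E; field.
    rewrite ler_pM2l//; apply: le_trans h1.
    by rewrite ler_wpM2r// divr_ge0 ?sqr_ge0.
lra.
Qed.

Lemma trivial_bound (A : R -> R) (y tau a b : R) :
  (forall t : R, 0 <= t -> is_derive t 1 A (cos (phase y tau t))) ->
  0 <= a -> a <= b -> `|A b - A a| <= b - a.
Proof.
move=> dA a0 ab; apply: (@norm_le_of_derive_le R A (fun t => t) (fun t => cos (phase y tau t))
  (fun=> 1)) => // t /andP[ta _].
- exact/dA/(le_trans a0).
- by rewrite ler_norml cos_geN1 cos_le1.
Qed.

(** [w] plays the part of y^(-1/4), and [u] is the stationary point in units of [w]. Each side of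
    that point has one bound of order 1 / u and one that is good for small [u]. *)
Lemma phase_integral_bound (A : R -> R) (y tau w T : R) :
  0 < y -> 0 < w -> 1 <= y * w ^+ 4 ->
  (forall t : R, 0 <= t -> is_derive t 1 A (cos (phase y tau t))) ->
  0 <= T -> `|A T - A 0| <= 33 / 10 * w.
Proof.
move=> y0 w0 yw dA T0.
have [ty|ty] := leP tau y.
  have := right_quartic y0 w0 yw dA (lexx _) T0.
  by rewrite cosh0 mulr1 add0r => /(_ ty); lra.
have tau0 : 0 < tau by rewrite (lt_trans y0).
have c1 : 1 <= tau / y by rewrite ler_pdivlMr// mul1r ltW.
(* On [0, tau / y] cosh climbs from 1 to at least [tau / y], because cosh c >= c. *)
have [|||t0 t00 ct0] := @IVT R (@coshR R) 0 (tau / y) (tau / y).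
- by rewrite (le_trans ler01).
- apply: continuous_subspaceT => t; exact: der_continuous (der_cosh (der_id t)).
- rewrite cosh0 ge_min c1 /= le_max cosh_ge_id ?orbT//.
  by rewrite (le_trans ler01).
have {}ht : tau = y * coshR t0 by rewrite ct0 mulrCA divff ?mulr1// gt_eqF.
have {t00}t0gt : 0 < t0.
  move: t00; rewrite in_itv /= => /andP[]; rewrite le_eqVlt => /orP[/eqP t0E|//].
  by move: ty; rewrite ht -t0E cosh0 mulr1 ltxx.
pose u := t0 / w.
have t0E : t0 = u * w by rewrite divfK// gt_eqF.
have u0 : 0 < u by rewrite divr_gt0.
have left1 c : 0 <= c -> c <= t0 -> `|A c - A 0| <= 15 / 4 * w / u.
  move=> c0 ct.
  have := @left_quadratic A y tau w t0 (t0 - c) t0 u y0 w0 yw dA u0 t0E ht.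
  rewrite subKr subrr distrC; apply => //.
  - by rewrite subr_ge0.
  - by rewrite lerBlDr lerDl.
have left2 c : 0 <= c -> c <= t0 -> `|A c - A 0| <= u * w.
  by move=> c0 ct; rewrite (le_trans (trivial_bound dA _ c0))// subr0 -t0E.
have [Tt|tT] := leP T t0.
  have := left1 T T0 Tt; have := left2 T T0 Tt.
  have [u2 h _|u2 _ h] := leP u 2.
    rewrite (le_trans h)// ler_pM2r//; lra.
  rewrite (le_trans h)// ler_pdivrMr//.
  have : 0 <= w * (u - 2) by rewrite mulr_ge0 ?(ltW w0)// subr_ge0 ltW.
  lra.
have b0 : 0 <= T - t0 by rewrite subr_ge0 ltW.
have ht' : tau <= y * coshR t0 by rewrite ht.
have := left1 t0 (ltW t0gt) (lexx _); have := left2 t0 (ltW t0gt) (lexx _).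
have := right_quartic y0 w0 yw dA (ltW t0gt) b0 ht'; have := right_quadratic y0 w0 yw dA u0 t0E b0 ht'.
have -> : t0 + (T - t0) = T by rewrite addrC subrK.
move=> r1 r2 l1 l2.
have tri : `|A T - A 0| <= `|A T - A t0| + `|A t0 - A 0| by exact: ler_distD.
apply: (le_trans tri).
(* In units of [w] the sums are 5.99 / u for [u] at least 2, 2.31 + u for [u] at most 0.98, and 2.24
   / u + u in between; on these ranges all stay below 3.3. *)
have [u2|u2] := leP 2 u.
  apply: (le_trans (lerD r1 l2)).
  have : 0 <= w * (u - 2) by rewrite mulr_ge0 ?(ltW w0)// subr_ge0.
  by rewrite -mulrDl ler_pdivrMr//; lra.
have [u1|u1] := leP u (98 / 100).
  by apply: (le_trans (lerD r2 l1)); rewrite -mulrDl ler_pM2r//; lra.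
apply: (le_trans (lerD r1 l1)).
have -> : 56 / 25 * w / u + u * w = (56 / 25 + u * u) / u * w.
  by field; rewrite gt_eqF.
rewrite ler_pM2r// ler_pdivrMr//; nra.
Qed.

End HyperbolicPhase.

(** * Primitives of continuous functions and integrals over [0, T] *)

Section Primitives.
Variable R : realType.
Let mu := @lebesgue_measure R.

Lemma derivable_continuous (f : R -> R) :
  (forall t : R, exists d, is_derive t 1 f d) -> continuous f.
Proof. by move=> fd t; have [d /der_continuous] := fd t. Qed.

Lemma continuous_integrable_segment (g : R -> R) (a b : R) : continuous g ->
  mu.-integrable `[a, b]%classic (EFin \o g).
Proof.
move=> cg; apply: continuous_compact_integrable; first exact: segment_compact.
exact: continuous_subspaceT.
Qed.

Lemma primitive_of_continuous (g : R -> R) : continuous g ->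
  exists2 G : R -> R, (forall t : R, 0 <= t -> is_derive t 1 G (g t)) &
    forall T : R, 0 <= T -> \int[mu]_(t in `[0, T]%classic) g t = G T - G 0.
Proof.
move=> cg; have gint := @continuous_integrable_segment g _ _ cg.
(* Integrating from -1 makes 0 an interior point, so the derivative there is two-sided. *)
exists (fun x => \int[mu]_(t in `[(-1), x]%classic) g t) => [t t0|T T0].
  have tu : t < t + 1 by rewrite ltrDl.
  have t1 : -1 < t by rewrite (lt_le_trans _ t0).
  have [dG G'E] := continuous_FTC1_closed tu (gint _ _) t1 (cg t).
  by apply: DeriveDef; [exact: dG|rewrite -derive1E; exact: G'E].
have := @Rintegral_itvB R g (BLeft (-1)) (BRight T) 0 (gint _ _).
rewrite !bnd_simp => /(_ _ T0) ->; last by rewrite lerN10.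
rewrite Rintegral_itv_obnd_cbnd//.
apply: integrableS (gint 0 T) => //.
exact: subset_itv_oc_cc.
Qed.

Lemma Rintegral_of_derive (V g : R -> R) (T : R) : 0 <= T -> continuous g ->
  (forall t : R, 0 <= t -> is_derive t 1 V (g t)) ->
  \int[mu]_(t in `[0, T]%classic) g t = V T - V 0.
Proof.
move=> T0 cg dV; have [G dG ->//] := primitive_of_continuous cg.
apply/eqP; rewrite -subr_eq0 -normr_le0.
have -> : G T - G 0 - (V T - V 0) = (G T - V T) - (G 0 - V 0) by ring.
apply: (@le_trans _ _ (0 - 0)); last by rewrite subrr.
apply: (@norm_le_of_derive_le R (fun t => G t - V t) (fun=> 0) (fun=> 0) (fun=> 0)) => //.
- move=> t /andP[t0 _]; apply: der_eq; eexists.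
    by eapply der_add; [exact: dG|eapply der_opp; exact: dV].
  by rewrite subrr.
- by move=> t _; rewrite normr0.
Qed.

End Primitives.

(** * Shifting the contour to the line Im z = th *)

Section Contour.
Variable R : realType.
Let mu := @lebesgue_measure R.
Implicit Types x tau th t T : R.

(* Real and imaginary part of exp(- x cosh z + i tau z) at z = t + i th. *)
Definition rotated_re x tau th t :=
  expR (- (x * coshR t * cos th) - tau * th) * cos (tau * t - x * sinhR t * sin th).
Definition rotated_im x tau th t :=
  expR (- (x * coshR t * cos th) - tau * th) * sin (tau * t - x * sinhR t * sin th).

Definition rotated_dth x tau th t :=
  expR (- (x * coshR t * cos th) - tau * th) *
  ((x * coshR t * sin th - tau) * cos (tau * t - x * sinhR t * sin th) +
   x * sinhR t * cos th * sin (tau * t - x * sinhR t * sin th)).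

Lemma der_rotated_re_th x tau th t :
  is_derive th 1 (rotated_re x tau ^~ t) (rotated_dth x tau th t).
Proof. by rewrite /rotated_re; der; rewrite /rotated_dth; ring. Qed.

(** With [der_rotated_re_th], a Cauchy-Riemann equation: it trades a derivative in [th] for one in
    [t]. *)
Lemma der_rotated_im_t x tau th t :
  is_derive t 1 (rotated_im x tau th) (- rotated_dth x tau th t).
Proof. by rewrite /rotated_im; der; rewrite /rotated_dth; ring. Qed.

Lemma continuous_rotated_re x tau th : continuous (rotated_re x tau th).
Proof.
apply: derivable_continuous => t; eexists; rewrite /rotated_re.
by der; reflexivity.
Qed.

Lemma continuous_rotated_dth x tau th : continuous (rotated_dth x tau th).
Proof.
apply: derivable_continuous => t; eexists; rewrite /rotated_dth.
by der; reflexivity.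
Qed.

(** A constant bound for [t] in [0, T] and bounded [th], which dominates when differentiating under
    the integral. *)
Lemma norm_rotated_dth_le x tau th t T M : 0 < x -> 0 < tau -> 0 <= t <= T ->
  `|th| <= M ->
  `|rotated_dth x tau th t| <=
    expR (x * coshR T + tau * M) * (x * coshR T + tau + x * sinhR T).
Proof.
move=> x0 tau0 /andP[t0 tT] thM.
have T0 := le_trans t0 tT.
have c0 : 0 <= coshR t by rewrite (le_trans ler01)// cosh_ge1.
have cT : coshR t <= coshR T by exact: cosh_le.
have sT : sinhR t <= sinhR T.
  rewrite -subr_ge0 -[X in X <= _](subrr 0).
  apply: (@le_of_derive_le R (fun=> 0) (fun t => sinhR t) (fun=> 0)
    (fun t => coshR t * 1)) => // u _; first by der.
  by rewrite mulr1 (le_trans ler01)// cosh_ge1.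
have cosn (a : R) : `|cos a| <= 1 by rewrite ler_norml cos_geN1 cos_le1.
have sinn (a : R) : `|sin a| <= 1 by rewrite ler_norml sin_geN1 sin_le1.
rewrite /rotated_dth normrM (ger0_norm (expR_ge0 _)).
apply: ler_pM => //.
  rewrite ler_expR lerD//.
    apply: (@le_trans _ _ `|x * coshR t * cos th|).
      by rewrite ler_normr lexx orbT.
    rewrite normrM ger0_norm ?mulr_ge0 ?(ltW x0)//.
    by rewrite (@le_trans _ _ (x * coshR t))// ?ler_piMr ?mulr_ge0 ?(ltW x0)// ler_pM2l.
  rewrite -mulrN ler_pM2l// (le_trans _ thM)// ler_normr lexx orbT//.
apply: (le_trans (ler_normD _ _)); apply: lerD.
  rewrite normrM (@le_trans _ _ (`|x * coshR t * sin th - tau| * 1))//.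
    by rewrite ler_wpM2l.
  rewrite mulr1 (le_trans (ler_normB _ _))// lerD//; last by rewrite gtr0_norm.
  rewrite normrM ger0_norm ?mulr_ge0 ?(ltW x0)//.
  by rewrite (@le_trans _ _ (x * coshR t))// ?ler_piMr ?mulr_ge0 ?(ltW x0)// ler_pM2l.
have s0 : 0 <= x * sinhR t by rewrite mulr_ge0 ?(ltW x0)// sinh_ge0.
rewrite -mulrA normrM (ger0_norm s0).
apply: (@le_trans _ _ (x * sinhR t)); last by rewrite ler_pM2l.
by rewrite ler_piMr// normrM mulr_ile1.
Qed.

(** By Cauchy-Riemann the differentiated integrand is an exact [t]-derivative, so only values at the
    endpoints remain. *)
Lemma der_rotated_integral x tau th T : 0 < x -> 0 < tau -> 0 <= T ->
  is_derive th 1 (fun th => \int[mu]_(t in `[0, T]%classic) rotated_re x tau th t)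
    (- rotated_im x tau th T).
Proof.
move=> x0 tau0 T0.
pose M := `|th| + 1.
pose C := expR (x * coshR T + tau * M) * (x * coshR T + tau + x * sinhR T).
have C0 : 0 <= C.
  have cT0 : 0 <= coshR T by rewrite (le_trans ler01)// cosh_ge1.
  have xc0 := mulr_ge0 (ltW x0) cT0.
  have xs0 := mulr_ge0 (ltW x0) (sinh_ge0 T0).
  by rewrite mulr_ge0 ?expR_ge0// addr_ge0// addr_ge0// ltW.
have dE u t : partial1of2 (rotated_re x tau) u t = rotated_dth x tau u t.
  rewrite partial1of2E.
  by have := der_rotated_re_th x tau u t => -[].
have thI : (`]th - 1, th + 1[%classic : set R) th.
  by rewrite /= in_itv /= ltrBlDr !ltrDl ltr01.
have ub u t : (`]th - 1, th + 1[%classic : set R) u -> `[0, T]%classic t ->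
    `|partial1of2 (rotated_re x tau) u t| <= (fun=> C) t.
  rewrite /= !in_itv /= => /andP[u1 u2] tT.
  rewrite dE norm_rotated_dth_le//.
  rewrite /M -(subrK th u) addrC (le_trans (ler_normD _ _))// lerD2l.
  by rewrite ler_norml; lra.
have intf u : (`]th - 1, th + 1[%classic : set R) u ->
    mu.-integrable `[0, T]%classic (EFin \o rotated_re x tau u).
  by move=> _; apply: continuous_integrable_segment; exact: continuous_rotated_re.
have derf u t : (`]th - 1, th + 1[%classic : set R) u -> `[0, T]%classic t ->
    derivable (rotated_re x tau ^~ t) u 1.
  by move=> _ _; have [] := der_rotated_re_th x tau u t.
have intC : mu.-integrable `[0, T]%classic (EFin \o (fun=> C)).
  by apply: continuous_integrable_segment => t; exact: cst_continuous.
have mT : measurable (`[0, T]%classic : set R) by [].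
have d1 := @derivable_under_integral R _ _ mu _ _ mT _ _ _ thI intf derf
  _ (fun=> C0) intC ub.
have d2 := @differentiation_under_integral R _ _ mu _ _ mT _ _ _ thI intf derf
  _ (fun=> C0) intC ub.
split => //; rewrite -derive1E d2.
under eq_Rintegral do rewrite dE.
have dV t : 0 <= t -> is_derive t 1 (fun t => - rotated_im x tau th t)
    (rotated_dth x tau th t).
  move=> _; apply: der_eq; eexists; first by eapply der_opp; exact: der_rotated_im_t.
  by rewrite opprK.
rewrite (Rintegral_of_derive T0 _ dV); last exact: continuous_rotated_dth.
(* The imaginary part vanishes at t = 0: the vertical side through 0 contributes nothing. *)
rewrite {2}/rotated_im sinh0 !mulr0 mul0r subrr sin0 mulr0 oppr0 subr0//.
Qed.

(** The error is the vertical side at Re z = T. As cos decreases on [0, pi], the decay is weakest at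
    [th]; the factor exp(- tau s) is bounded by 1. *)
Lemma contour_shift x tau th T : 0 < x -> 0 < tau -> 0 <= T -> 0 <= th <= pi / 2 ->
  `|\int[mu]_(t in `[0, T]%classic) rotated_re x tau th t -
    \int[mu]_(t in `[0, T]%classic) rotated_re x tau 0 t| <=
  expR (- (x * coshR T * cos th)) * th.
Proof.
move=> x0 tau0 T0 /andP[th0 thpi].
set c := expR (- (x * coshR T * cos th)).
have -> : c * th = c * th - c * 0 by rewrite mulr0 subr0.
apply: (@norm_le_of_derive_le R
  (fun th => \int[mu]_(t in `[0, T]%classic) rotated_re x tau th t)
  (fun s => c * s)
  (fun th => - rotated_im x tau th T) (fun=> c)) => //.
- by move=> s _; exact: der_rotated_integral.
- by move=> s _; der; ring.
- move=> s /andP[s0 sth].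
  rewrite normrN normrM (ger0_norm (expR_ge0 _)).
  apply: (@le_trans _ _ (expR (- (x * coshR T * cos s) - tau * s))).
    by rewrite ler_piMr ?expR_ge0// ler_norml sin_geN1 sin_le1.
  have pi2 : pi / 2 <= pi :> R by have := pi_gt0 R; lra.
  have spi : s <= pi by rewrite (le_trans sth)// (le_trans thpi).
  have thpi' : th <= pi by rewrite (le_trans thpi).
  have cs : cos th <= cos s.
    by rewrite leNgt ltr_cos -?leNgt// in_itv/= ?s0 ?spi ?th0 ?thpi'.
  rewrite ler_expR -[leRHS]subr0 lerB ?mulr_ge0 ?(ltW tau0)//.
  by rewrite lerN2 ler_wpM2l// mulr_ge0 ?(ltW x0)// (le_trans ler01)// cosh_ge1.
Qed.

End Contour.

(** * The bound for K_{i tau}(x): T to infinity, then th to pi / 2 *)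

Section Macdonald.
Variable R : realType.
Let mu := @lebesgue_measure R.
Implicit Types x tau th t T w : R.

Lemma rotated_integral_bound x tau th T w : 0 < x -> 0 < tau -> 0 < th < pi / 2 ->
  0 < w -> 1 <= x * sin th * w ^+ 4 -> 0 <= T ->
  `|\int[mu]_(t in `[0, T]%classic) rotated_re x tau th t| <=
    33 / 10 * w * expR (- (tau * th)).
Proof.
move=> x0 tau0 /andP[th0 thpi] w0 xw T0.
have pi2 : pi / 2 < pi :> R by have := pi_gt0 R; lra.
have y0 : 0 < x * sin th.
  by rewrite mulr_gt0// sin_gt0_pi// th0 (lt_trans thpi).
have c0 : 0 <= cos th.
  by rewrite cos_ge0_pihalf// (ltW thpi) andbT (le_trans _ (ltW th0))// oppr_le0 divr_ge0// pi_ge0.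
set y := x * sin th in xw y0.
have [A dA _] : exists2 G : R -> R,
    (forall t : R, 0 <= t -> is_derive t 1 G (cos (phase y tau t))) &
    forall T : R, 0 <= T -> \int[mu]_(t in `[0, T]%classic) cos (phase y tau t) = G T - G 0.
  apply: primitive_of_continuous; apply: derivable_continuous => t; eexists.
  by eapply der_cos; exact: der_phase.
have [E dE ->//] := primitive_of_continuous (@continuous_rotated_re R x tau th).
(* The nonincreasing weight. The phase occurs with the opposite sign in [rotated_re], which the even
   cosine ignores. *)
pose al t := expR (- (x * coshR t * cos th) - tau * th).
have reE t : rotated_re x tau th t = al t * cos (phase y tau t).
  by rewrite /rotated_re -[cos (phase _ _ _)]cosN; congr (_ * cos _); rewrite /phase /y; ring.
apply: (@le_trans _ _ (33 / 10 * w * al 0)).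
  apply: (@second_mean_value_bound R A E al (fun t => cos (phase y tau t))
    (fun t => al t * - (x * sinhR t * cos th))) => //.
  - by move=> t /andP[t0 _]; exact: dA.
  - by move=> t /andP[t0 _]; rewrite -reE; exact: dE.
  - by move=> t _; rewrite /al; der; ring.
  - move=> t /andP[t0 _]; rewrite mulrN oppr_le0.
    apply: mulr_ge0; first exact: expR_ge0.
    by rewrite mulr_ge0// mulr_ge0 ?sinh_ge0// ltW.
  - exact: expR_ge0.
  - by move=> t /andP[t0 _]; exact: phase_integral_bound dA t0.
rewrite ler_wpM2l//; first by rewrite mulr_ge0 ?(ltW w0)//; lra.
(* The factor exp(- x cos th) of [al 0] is at most 1. *)
rewrite /al ler_expR cosh0 mulr1 gerDr oppr_le0 mulr_ge0//.
exact: ltW.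
Qed.

Lemma expR_tail x T : 0 < x ->
  (\int[mu]_(t in `[T, +oo[%classic) (expR (- (x * t)))%:E = (expR (- (x * T)) / x)%:E)%E.
Proof.
move=> x0.
have dF t : is_derive t 1 (fun t => - (expR (- (x * t)) / x)) (expR (- (x * t))).
  by der; field; rewrite gt_eqF.
have cF t : {for t, continuous (fun t => - (expR (- (x * t)) / x))}.
  exact: der_continuous (dF t).
have ce : continuous (fun t => expR (- (x * t))).
  apply: derivable_continuous => t; eexists.
  by eapply der_expR; eapply der_opp; eapply der_mul; [exact: der_cst|exact: der_id].
rewrite (@ge0_continuous_FTC2y R _ (fun t => - (expR (- (x * t)) / x)) T 0).
- by rewrite -EFinB sub0r opprK.
- by move=> t _; exact: expR_ge0.
- exact: continuous_subspaceT.
- have -> : (0 : R) = - (0 * x^-1) by rewrite mul0r oppr0.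
  apply: cvgN; apply: cvgM; last exact: cvg_cst.
  apply: (@cvg_comp _ _ _ (fun t => x * t) (fun t => expR (- t)) _ (pinfty_nbhs R)).
    exact: gt0_cvgMry.
  exact: cvgr_expR.
- by move=> t _; have [] := dF t.
- exact: cvg_at_right_filter (cF T).
- by move=> t _; have [_ <-] := dF t; rewrite derive1E.
Qed.

Lemma integrable_expR_tail x T : 0 < x ->
  mu.-integrable `[T, +oo[%classic (fun t => (expR (- (x * t)))%:E).
Proof.
move=> x0; apply/integrableP; split.
  apply/measurable_EFinP; apply: measurable_funTS; apply: continuous_measurable_fun.
  apply: derivable_continuous => t; eexists.
  by eapply der_expR; eapply der_opp; eapply der_mul; [exact: der_cst|exact: der_id].
under eq_integral do rewrite abse_EFin ger0_norm ?expR_ge0//.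
by rewrite expR_tail// ltry.
Qed.

Lemma rotated_re0 x tau t : rotated_re x tau 0 t = expR (- (x * coshR t)) * cos (tau * t).
Proof. by rewrite /rotated_re cos0 sin0 !mulr0 !subr0 mulr1. Qed.

Lemma rotated_re0_le x tau t : 0 < x -> 0 <= t ->
  `|rotated_re x tau 0 t| <= expR (- (x * t)).
Proof.
move=> x0 t0; rewrite rotated_re0 normrM (ger0_norm (expR_ge0 _)).
apply: (@le_trans _ _ (expR (- (x * coshR t)))).
  by rewrite ler_piMr ?expR_ge0// ler_norml cos_geN1 cos_le1.
by rewrite ler_expR lerN2 ler_pM2l// cosh_ge_id.
Qed.

(** Since cosh t >= t, the tail is dominated by exp(- x t), whose integral is explicit. *)
Lemma macdonald_truncation x tau T : 0 < x -> 0 <= T ->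
  `|macdonald_im tau x - \int[mu]_(t in `[0, T]%classic) rotated_re x tau 0 t| <=
    expR (- (x * T)) / x.
Proof.
move=> x0 T0.
have mk : measurable_fun setT (rotated_re x tau 0).
  by apply: continuous_measurable_fun; exact: continuous_rotated_re.
have ik : mu.-integrable `[0, +oo[%classic (EFin \o rotated_re x tau 0).
  apply: (le_integrable _ _ _ (integrable_expR_tail 0 x0)) => //.
    by apply/measurable_EFinP; exact: measurable_funTS.
  move=> t /=; rewrite in_itv /= andbT => t0.
  by rewrite lee_fin (ger0_norm (expR_ge0 _)) rotated_re0_le.
have -> : macdonald_im tau x = \int[mu]_(t in `[0, +oo[%classic) rotated_re x tau 0 t.
  by apply: eq_Rintegral => t _; rewrite rotated_re0.
rewrite (Rintegral_itvB ik) ?bnd_simp//.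
have sub : (`]T, +oo[ `<=` (`[0, +oo[ : set R))%classic.
  by apply: subset_itvr; rewrite bnd_simp.
have sub' : (`]T, +oo[ `<=` (`[T, +oo[ : set R))%classic.
  by apply: subset_itvr; rewrite bnd_simp.
have ikT : mu.-integrable `]T, +oo[%classic (EFin \o rotated_re x tau 0).
  by apply: integrableS ik.
have ieT : mu.-integrable `]T, +oo[%classic (EFin \o (fun t => expR (- (x * t)))).
  by apply: integrableS (integrable_expR_tail T x0).
apply: (le_trans (le_normr_Rintegral _ ikT)) => //.
have -> : expR (- (x * T)) / x = \int[mu]_(t in `]T, +oo[%classic) expR (- (x * t)).
  rewrite Rintegral_itv_obnd_cbnd//.
  by rewrite /Rintegral expR_tail.
apply: le_Rintegral => //.
  exact: integrable_norm ikT.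
move=> t /=; rewrite in_itv /= andbT => tT.
by rewrite rotated_re0_le// (le_trans T0)// ltW.
Qed.

Lemma le_of_le_add_inv (a b C : R) : 0 <= C ->
  (forall T, 0 < T -> a <= b + C / T) -> a <= b.
Proof.
move=> C0 h; apply/ler_addgt0Pr => e e0.
have C1 : 0 < C + 1 by rewrite ltr_wpDl.
(* This choice gives C / T <= e; [C + 1] instead of [C] keeps it positive when [C = 0]. *)
apply: le_trans (h ((C + 1) / e) _) _; first by rewrite divr_gt0.
rewrite lerD2l invf_div mulrA ler_pdivrMr// mulrC ler_pM2l//.
by rewrite lerDl.
Qed.

Lemma expRN_le_inv (a : R) : 0 < a -> expR (- a) <= a^-1.
Proof.
move=> a0; rewrite expRN lef_pV2 ?posrE ?expR_gt0//.
by rewrite (le_trans _ (expR_ge1Dx a))// lerDr.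
Qed.

Lemma macdonald_rotated_bound x tau th w : 0 < x -> 0 < tau -> 0 < th < pi / 2 ->
  0 < w -> 1 <= x * sin th * w ^+ 4 ->
  `|macdonald_im tau x| <= 33 / 10 * w * expR (- (tau * th)).
Proof.
move=> x0 tau0 thI w0 xw; have /andP[th0 thpi] := thI.
have c0 : 0 < cos th.
  rewrite cos_gt0_pihalf// thpi andbT (lt_trans _ th0)// oppr_lt0 divr_gt0//.
  exact: pi_gt0.
(* The summands come from the truncation and from the vertical side at T, by exp(- a) <= 1 / a and
   cosh T >= T. *)
apply: (@le_of_le_add_inv _ _ (x^-1 / x + (x * cos th)^-1 * th)).
  by rewrite addr_ge0// ?mulr_ge0 ?invr_ge0 ?mulr_ge0 ?(ltW x0) ?(ltW c0) ?(ltW th0).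
move=> T T0.
have h1 := @macdonald_truncation x tau T x0 (ltW T0).
have thI' : 0 <= th <= pi / 2 by rewrite !ltW.
have h2 := contour_shift x0 tau0 (ltW T0) thI'.
have h3 := rotated_integral_bound x0 tau0 thI w0 xw (ltW T0).
have xT : 0 < x * T by rewrite mulr_gt0.
have xcT : 0 < x * coshR T * cos th.
  have ch0 : 0 < coshR T by rewrite (lt_le_trans ltr01)// cosh_ge1.
  exact: mulr_gt0 (mulr_gt0 x0 ch0) c0.
have e1 : expR (- (x * T)) / x <= x^-1 / x / T.
  rewrite mulrAC ler_pM2r ?invr_gt0//.
  by rewrite (le_trans (expRN_le_inv xT))// invfM.
have e2 : expR (- (x * coshR T * cos th)) * th <= (x * cos th)^-1 * th / T.
  rewrite [leRHS]mulrAC ler_pM2r// (le_trans (expRN_le_inv xcT))//.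
  rewrite -invfM lef_pV2 ?posrE// ?mulr_gt0//.
  by rewrite [leRHS]mulrAC ler_pM2l ?mulr_gt0// cosh_ge_id// ltW.
rewrite mulrDl.
move: h1 h2 h3; rewrite !ler_norml.
move=> /andP[? ?] /andP[? ?] /andP[? ?]; apply/andP; split; lra.
Qed.

Lemma macdonald_bound x tau w : 0 < x -> 0 < tau -> 0 < w -> x * w ^+ 4 = 1 ->
  `|macdonald_im tau x| <= 33 / 10 * w * expR (- (tau * (pi / 2))).
Proof.
move=> x0 tau0 w0 xw.
have pi0 : 0 < pi / 2 :> R by rewrite divr_gt0// pi_gt0.
have pi2 : pi / 2 < pi :> R by have := pi_gt0 R; lra.
(* The rotated bound is applied with [w / sin th], admissible because x sin th (w / sin th)^4 = 1 /
   (sin th)^3 >= 1. Multiplied by [sin th] it reads [0 <= D th], which passes to the limit by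
   continuity. *)
pose D th := 33 / 10 * w * expR (- (tau * th)) - `|macdonald_im tau x| * sin th.
have dD th : exists d, is_derive th 1 D d by eexists; rewrite /D; der; reflexivity.
have cD : (D @ (pi / 2)^'- --> D (pi / 2))%classic.
  by apply: cvg_at_left_filter; exact: derivable_continuous dD _.
have D0 : (\forall th \near (pi / 2)^'-, 0 <= D th)%classic.
  near=> th.
  have th0 : 0 < th by near: th; exact: nbhs_left_gt.
  have thpi : th < pi / 2 by near: th; exact: nbhs_left_lt.
  have s0 : 0 < sin th by rewrite sin_gt0_pi// th0 (lt_trans thpi).
  have s1 : sin th <= 1 := sin_le1 th.
  rewrite subr_ge0 -ler_pdivlMr//.
  have -> : 33 / 10 * w * expR (- (tau * th)) / sin th =
     33 / 10 * (w / sin th) * expR (- (tau * th)) by ring.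
  apply: macdonald_rotated_bound => //; rewrite ?th0 ?divr_gt0//.
  have -> : x * sin th * (w / sin th) ^+ 4 = x * w ^+ 4 * (sin th ^+ 3)^-1.
    by field; rewrite gt_eqF.
  by rewrite xw mul1r invf_ge1 ?exprn_gt0// exprn_ile1// ltW.
have : 0 <= D (pi / 2) by exact: cvgr_to_ge cD D0.
by rewrite /D sin_pihalf mulr1 subr_ge0.
Unshelve. all: by end_near. Qed.

End Macdonald.

(** * Integrability of Euler's integral at 1/4 and a lower bound for its value *)

Section GammaQuarter.
Variable R : realType.
Let mu := @lebesgue_measure R.
Implicit Types t a b : R.

(** Alternating Taylor bounds, each integrated from the previous one, starting with
    [1 - s <= expR (- s)]. *)
Lemma expRN_ge_cubic t : 0 <= t ->
  1 - t + t ^+ 2 / 2 - t ^+ 3 / 6 <= expR (- t).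
Proof.
have lin (s : R) : 0 <= s -> 1 - s <= expR (- s) by move=> _; exact: expR_ge1Dx.
have quad (s : R) : 0 <= s -> expR (- s) <= 1 - s + s ^+ 2 / 2.
  move=> s0; have := @le_of_derive_le R (fun s => expR (- s)) (fun s => - s + s ^+ 2 / 2)
    (fun s => - expR (- s)) (fun s => - 1 + s) 0 s s0.
  rewrite !oppr0 expR0 expr0n mul0r addr0 subr0 lerBlDr [_ + 1]addrC addrA; apply.
  - by move=> u _; der; ring.
  - by move=> u _; der; field.
  - by move=> u /andP[u0 _]; have := lin u u0; lra.
move=> t0; have := @le_of_derive_le R (fun s => - s + s ^+ 2 / 2 - s ^+ 3 / 6)
  (fun s => expR (- s)) (fun s => - 1 + s - s ^+ 2 / 2) (fun s => - expR (- s)) 0 t t0.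
rewrite !oppr0 expR0 !expr0n !mul0r !oppr0 !addr0 subr0 lerBrDl !addrA; apply.
- by move=> u _; der; field.
- by move=> u _; der; ring.
- by move=> u /andP[u0 _]; have := quad u u0; lra.
Qed.

Lemma integral_derive_pos (V g : R -> R) a b : 0 < a -> a < b ->
  (forall t : R, 0 < t -> is_derive t 1 V (g t)) ->
  (forall t : R, 0 < t -> exists d, is_derive t 1 g d) ->
  (\int[mu]_(t in `[a, b]%classic) (g t)%:E = (V b - V a)%:E)%E.
Proof.
move=> a0 ab dV dg.
have b0 := lt_trans a0 ab.
rewrite (@continuous_FTC2 R g V a b ab).
- by rewrite EFinB.
- apply: continuous_in_subspaceT => t /[1!inE] /=; rewrite in_itv /= => /andP[ta _].
  by have [d /der_continuous] := dg t (lt_le_trans a0 ta).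
- split.
  + move=> t; rewrite in_itv /= => /andP[ta _].
    by have [] := dV t (lt_trans a0 ta).
  + exact/cvg_at_right_filter/der_continuous/dV.
  + exact/cvg_at_left_filter/der_continuous/dV.
- move=> t; rewrite in_itv /= => /andP[ta _].
  by have [_ <-] := dV t (lt_trans a0 ta); rewrite derive1E.
Qed.

Let q t := t `^ (1 / 4).
Let q3 t := t `^ (1 / 4 - 1).

Lemma powR_quarter_pow4 t : 0 <= t -> (t `^ (1 / 4)) ^+ 4 = t.
Proof.
move=> t0; rewrite -powR_mulrn ?powR_ge0// -powRrM.
by rewrite divfK ?pnatr_eq0// powRr1.
Qed.

Lemma powR_quarter_mul t : 0 < t -> t * t `^ (1 / 4 - 1) = t `^ (1 / 4).
Proof.
move=> t0; rewrite powRB; last by rewrite (gt_eqF t0) implybT.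
by rewrite powRr1 ?ltW// mulrCA divff ?mulr1// gt_eqF.
Qed.

Let dq t : 0 < t -> is_derive t 1 q (1 / 4 * q3 t).
Proof. by move=> t0; exact: is_derive1_powR. Qed.

Let dq3 t : 0 < t -> exists d, is_derive t 1 q3 d.
Proof. by move=> t0; eexists; exact: is_derive1_powR. Qed.

Definition gamma_quarter_integrand t := t `^ (1 / 4 - 1) * expR (- t).

Let f := gamma_quarter_integrand.

Lemma measurable_gamma_quarter_integrand : measurable_fun setT f.
Proof.
apply: measurable_funM; first exact: measurable_powR.
apply: continuous_measurable_fun; apply: derivable_continuous => t; eexists.
by eapply der_expR; eapply der_opp; exact: der_id.
Qed.

Let f_ge0 t : 0 <= f t.
Proof. by rewrite mulr_ge0 ?powR_ge0 ?expR_ge0. Qed.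

(* With s = t^(1/4), the integrand is at most 4 t^(-3/4) / (1 + s)^2, the
   derivative of - 16 / (1 + s), which is bounded. *)
Lemma gamma_quarter_segment_le a b : 0 < a -> a < b ->
  (\int[mu]_(t in `[a, b]%classic) (f t)%:E <= 16%:E)%E.
Proof.
move=> a0 ab.
pose V t := - (16 * (1 + q t)^-1).
pose g t := 4 * (q3 t * ((1 + q t)^-1 * (1 + q t)^-1)).
have q0 t : 0 <= q t by exact: powR_ge0.
have q1 t : 0 < 1 + q t by rewrite ltr_wpDr.
have dinv t : 0 < t ->
    is_derive t 1 (fun t => (1 + q t)^-1) (- (1 + q t) ^- 2 * (0 + 1 / 4 * q3 t)).
  move=> t0; apply: der_inv; first by rewrite gt_eqF.
  exact: der_add (der_cst 1 t) (dq t0).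
have dV t : 0 < t -> is_derive t 1 V (g t).
  move=> t0; apply: der_eq; eexists.
    by eapply der_opp; eapply der_mul; [exact: der_cst|exact: dinv].
  have qn : 1 + q t != 0 by rewrite gt_eqF.
  by lazy beta; rewrite /g; field.
have dg t : 0 < t -> exists d, is_derive t 1 g d.
  move=> t0; have [d hd] := dq3 t0; eexists.
  eapply der_mul; first exact: der_cst.
  by eapply der_mul; [exact: hd|eapply der_mul; exact: dinv].
have mseg : measurable (`[a, b]%classic : set R) by [].
have fg t : 0 < t -> f t <= g t.
  move=> t0; rewrite /f /gamma_quarter_integrand /g mulrCA.
  rewrite ler_wpM2l ?powR_ge0//.
  apply: (@le_trans _ _ (1 + t)^-1).
    by rewrite expRN lef_pV2 ?posrE ?expR_gt0 ?expR_ge1Dx// ltr_wpDl// ltW.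
  have -> : 4 * ((1 + q t)^-1 * (1 + q t)^-1) = 4 / (1 + q t) ^+ 2.
    by rewrite -invfM expr2.
  rewrite -{1}(powR_quarter_pow4 (ltW t0)) -/(q t).
  rewrite ler_pdivlMr ?exprn_gt0// ler_pdivrMl; last by rewrite ltr_wpDr// exprn_ge0.
  (* These squares certify (1 + q)^2 <= 4 (1 + q^4). *)
  have h1 := sqr_ge0 (q t - 1).
  have h2 := sqr_ge0 (2 * q t ^+ 2 - 1); have h3 := sqr_ge0 (q t).
  lra.
apply: (@le_trans _ _ (\int[mu]_(t in `[a, b]%classic) (g t)%:E)%E).
  apply: ge0_le_integral => //.
  - by move=> t _; rewrite lee_fin.
  - apply/measurable_EFinP; apply: measurable_funTS.
    exact: measurable_gamma_quarter_integrand.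
  - apply/measurable_EFinP; apply: subspace_continuous_measurable_fun => //.
    apply: continuous_in_subspaceT => t /[1!inE] /=; rewrite in_itv /= => /andP[ta _].
    by have [d /der_continuous] := dg t (lt_le_trans a0 ta).
  - move=> t /=; rewrite in_itv /= => /andP[ta _].
    by rewrite lee_fin fg// (lt_le_trans a0).
rewrite (integral_derive_pos a0 ab dV dg) lee_fin /V.
have i1 : 0 < (1 + q b)^-1 by rewrite invr_gt0.
have i2 : (1 + q a)^-1 <= 1 by rewrite invf_le1// lerDl.
lra.
Qed.

(** Ensures that [GammaR (1 / 4)] is a genuine integral and not a default value. Monotone
    convergence carries the uniform bound 16 over to the half-line. *)
Lemma gamma_quarter_integrable : mu.-integrable `]0, +oo[%classic (EFin \o f).
Proof.
pose F (n : nat) : set R := `[n.+1%:R^-1, n.+1%:R]%classic.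
have FE : (`]0, +oo[%classic : set R) = (\bigcup_n F n)%classic.
  apply/seteqP; split => t /=.
    rewrite in_itv /= andbT => t0.
    have s0 : 0 <= t + t^-1 by rewrite addr_ge0// ?invr_ge0; exact: ltW.
    have /andP[_ ht] := truncn_itv s0.
    (* For this [n] both [t] and [t^-1] lie below n + 1. *)
    exists (Num.truncn (t + t^-1)) => //; rewrite /F /= in_itv /=; apply/andP; split.
      rewrite -[leRHS]invrK lef_pV2 ?posrE ?invr_gt0 ?ltr0n//.
      by rewrite (le_trans _ (ltW ht))// lerDr ltW.
    by rewrite (le_trans _ (ltW ht))// lerDl invr_ge0 ltW.
  move=> [n _]; rewrite /F /= !in_itv /= andbT => /andP[nt _].
  by rewrite (lt_le_trans _ nt)// invr_gt0 ltr0n.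
have mf D : measurable_fun D (EFin \o f).
  by apply/measurable_EFinP; apply: measurable_funTS; exact: measurable_gamma_quarter_integrand.
apply/integrableP; split; first exact: mf.
under eq_integral do rewrite /= ger0_norm//.
apply: (@le_lt_trans _ _ 16%:E); last exact: ltry.
rewrite FE.
have cF := @ge0_nondecreasing_set_cvg_integral _ (measurableTypeR R) R F (EFin \o f)
  (@lebesgue_measure R).
apply: (cvge_to_le (cF _ _ _ _)).
- apply/nondecreasing_seqP => n; rewrite subsetEset; apply: subset_itvScc.
  + by rewrite bnd_simp lef_pV2 ?posrE ?ltr0n// ler_nat.
  + by rewrite bnd_simp ler_nat.
- by move=> n; exact: measurable_itv.
- by move=> n; exact: mf.
- by move=> n t _; rewrite lee_fin.
- near=> n; apply: gamma_quarter_segment_le; first by rewrite invr_gt0 ltr0n.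
  have n0 : (0 < n)%N by near: n; exact: nbhs_infty_gt.
  apply: (@lt_trans _ _ 1); last by rewrite ltr1n ltnS.
  by rewrite invf_lt1 ?ltr0n// ltr1n ltnS.
Unshelve. all: by end_near. Qed.

(** Replacing exp(- t) by its cubic lower bound on (0, 1] would give about 3.37; cutting off at [a]
    loses at most 0.05. *)
Lemma gamma_quarter_ge : 33 / 10 <= GammaR (1 / 4 : R).
Proof.
(* The cutoff [a] is a fourth power so that a^(1/4) = e is rational. *)
pose e : R := 1 / 100.
have e0 : 0 < e by rewrite /e; lra.
have e1 : e < 1 by rewrite /e; lra.
pose a := e ^+ 4.
have a0 : 0 < a by rewrite exprn_gt0.
have a1 : a < 1 by rewrite exprn_ilt1// ltW.
have qa : q a = e.
  by rewrite /q /a -powR_mulrn ?ltW// -powRrM mulrC divfK ?pnatr_eq0// powRr1// ltW.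
have q1 : q 1 = 1 by rewrite /q powR1.
(* Termwise primitive of t^(-3/4) times the cubic. *)
pose V t := q t * (4 - 4 / 5 * t + 2 / 9 * t ^+ 2 - 2 / 39 * t ^+ 3).
pose g t := q3 t * (1 - t + t ^+ 2 / 2 - t ^+ 3 / 6).
have dV t : 0 < t -> is_derive t 1 V (g t).
  move=> t0; rewrite /V.
  have hp : is_derive t 1 (fun t => 4 - 4 / 5 * t + 2 / 9 * t ^+ 2 - 2 / 39 * t ^+ 3)
      (- (4 / 5) + 4 / 9 * t - 2 / 13 * t ^+ 2) by der; field.
  apply: der_eq; eexists; first by eapply der_mul; [exact: dq|exact: hp].
  by lazy beta; rewrite /q -(powR_quarter_mul t0) -/(q3 t) /g; field.
have dg t : 0 < t -> exists d, is_derive t 1 g d.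
  move=> t0; have [d hd] := dq3 t0.
  have hp : is_derive t 1 (fun t => 1 - t + t ^+ 2 / 2 - t ^+ 3 / 6)
      (- 1 + t - t ^+ 2 / 2) by der; field.
  by eexists; eapply der_mul; [exact: hd|exact: hp].
have gE := integral_derive_pos a0 a1 dV dg.
have Vle : 33 / 10 <= V 1 - V a.
  rewrite /V q1 qa.
  have ha : 0 <= a ^+ 3 by rewrite exprn_ge0// ltW.
  have ha2 : a ^+ 2 <= 1 by rewrite exprn_ile1// ltW.
  have h : 4 - 4 / 5 * a + 2 / 9 * a ^+ 2 - 2 / 39 * a ^+ 3 <= 5 by lra.
  have : e * (4 - 4 / 5 * a + 2 / 9 * a ^+ 2 - 2 / 39 * a ^+ 3) <= 1 / 100 * 5.
    by rewrite -/e ler_pM2l.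
  lra.
have mseg : measurable (`[a, 1]%classic : set R) by [].
have sub : (`[a, 1] `<=` (`]0, +oo[ : set R))%classic.
  by move=> t /=; rewrite !in_itv /= andbT => /andP[ta _]; exact: lt_le_trans ta.
have iE : (GammaR (1 / 4 : R))%:E = (\int[mu]_(t in `]0%R, +oo[%classic) (f t)%:E)%E.
  rewrite /GammaR /Rintegral fineK//.
  exact: integrable_fin_num gamma_quarter_integrable.
apply: (le_trans Vle); rewrite -lee_fin iE -gE.
apply: (@le_trans _ _ (\int[mu]_(t in `[a, 1%R]%classic) (f t)%:E)%E).
  apply: le_integral.
  - by [].
  - apply: continuous_compact_integrable; first exact: segment_compact.
    apply: continuous_in_subspaceT => t /[1!inE] /=; rewrite in_itv /= => /andP[ta _].
    by have [d /der_continuous] := dg t (lt_le_trans a0 ta).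
  - by apply: integrableS gamma_quarter_integrable.
  - move=> t; rewrite inE /= in_itv /= => /andP[ta _]; rewrite lee_fin.
    rewrite ler_wpM2l ?powR_ge0// expRN_ge_cubic//.
    exact: le_trans (ltW a0) ta.
apply: ge0_subset_integral => //.
- by apply/measurable_EFinP; apply: measurable_funTS; exact: measurable_gamma_quarter_integrand.
- by move=> t _; rewrite lee_fin.
Qed.

End GammaQuarter.

Theorem mainTheorem4 (R : realType) (x tau : R) (hx : 0 < x) (htau : 0 < tau) :
  `| macdonald_im tau x | <=
    GammaR (1 / 4 : R) / Num.sqrt 2 *
    (x `^ (- (1 / 4)) / Num.sqrt (sinhR (pi * tau))).
Proof.
pose w := x `^ (- (1 / 4)).
have w0 : 0 < w by rewrite powR_gt0.
have xw : x * w ^+ 4 = 1.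
  rewrite /w powRN exprVn powR_quarter_pow4 ?ltW// divff// gt_eqF//.
apply: (le_trans (macdonald_bound hx htau w0 xw)).
have pt0 : 0 < pi * tau by rewrite mulr_gt0// pi_gt0.
have S0 : 0 < sinhR (pi * tau) by rewrite (lt_le_trans pt0)// sinh_ge_id// ltW.
(* Squared, this is exp(pi tau) - exp(- pi tau) <= exp(pi tau). *)
have sq : Num.sqrt 2 * Num.sqrt (sinhR (pi * tau)) <= expR (tau * (pi / 2)).
  rewrite -sqrtrM ?ler0n// -[leRHS]ger0_norm ?expR_ge0// -sqrtr_sqr ler_wsqrtr//.
  rewrite -expRM_natl /sinhR.
  have -> : 2 * (tau * (pi / 2)) = pi * tau by field.
  by have := expR_ge0 (- (pi * tau)); lra.
have s2 : 0 < Num.sqrt 2 :> R by rewrite sqrtr_gt0 ltr0n.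
have sS : 0 < Num.sqrt (sinhR (pi * tau)) by rewrite sqrtr_gt0.
rewrite mulrACA -invfM [leRHS]mulrAC -/w.
have -> : GammaR (1 / 4) / (Num.sqrt 2 * Num.sqrt (sinhR (pi * tau))) * w =
  GammaR (1 / 4) * w * (Num.sqrt 2 * Num.sqrt (sinhR (pi * tau)))^-1 by ring.
apply: ler_pM.
- by rewrite mulr_ge0 ?(ltW w0)//; lra.
- exact: expR_ge0.
- by rewrite ler_pM2r// gamma_quarter_ge.
- by rewrite expRN lef_pV2 ?posrE ?expR_gt0// mulr_gt0.
Qed.
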